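(* Let $f$ be a Boolean function. Then $f$ is join-irreducible if and only if $\operatorname{ess} f\ge 2$ and $C_f$ is an equivalence class of $\approx$. Furthermore, if $\operatorname{gap} f=2$, then $f$ is join-irreducible and $C_f=[\operatorname{Ess} f]^2$.
   Context: A Boolean function of arity $n\ge1$ is a map $f\colon\{0,1\}^n\to\{0,1\}$. For $g$ of arity $m$ and $f$ of arity $n$, $g\le f$ if there is $\sigma\colon\{1,\dots,n\}\to\{1,\dots,m\}$ with $g(a_1,\dots,a_m)=f(a_{\sigma(1)},\dots,a_{\sigma(n)})$ for all $a_i\in\{0,1\}$; $f\equiv g$ means $f\le g$ and $g\le f$; $g<f$ means $g\le f$ and $f\not\le g$. The function $f$ is join-irreducible if there is $f'<f$ such that every $g<f$ satisfies $g\le f'$ (equivalently, the $\equiv$-class of $f$ has exactly one lower cover in the poset of $\equiv$-classes ordered by $\le$). The variable $x_i$ is essential in $f$ if for some values of the other arguments $x\mapsto f(a_1,\dots,a_{i-1},x,a_{i+1},\dots,a_n)$ is nonconstant; $\operatorname{Ess} f\subseteq\{1,\dots,n\}$ is the set of indices of essential variables, $\operatorname{ess} f=|\operatorname{Ess} f|$, and $[\operatorname{Ess} f]^2$ is the set of 2-element subsets of $\operatorname{Ess} f$. The arity gap is $\operatorname{gap} f=\min\{\operatorname{ess} f-\operatorname{ess} g: g<f\}$. For $i,j\in\{1,\dots,n\}$, $f_{i=j}$ denotes the function obtained by identifying $x_i$ with $x_j$: $f_{i=j}(a_1,\dots,a_n)=f(a_1,\dots,a_{i-1},a_j,a_{i+1},\dots,a_n)$.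 On $[\operatorname{Ess} f]^2$ define $\{i,j\}\approx\{i',j'\}$ iff $f_{i=j}\equiv f_{i'=j'}$ (an equivalence relation). Let $C_f=\{\{i,j\}\in[\operatorname{Ess} f]^2:\operatorname{ess} f_{i=j}=\operatorname{ess} f-\operatorname{gap} f\}$. *)

(* Defs.v *)
From mathcomp Require Import all_boot.
From mathcomp Require Import boolp classical_sets.

Set Implicit Arguments.
Unset Strict Implicit.
Unset Printing Implicit Defensive.

(* Arities are required to be positive; the type itself allows n = 0, so every
   quantification over Boolean functions below carries a hypothesis 0 < n. *)
Definition boolfun (n : nat) : Type := {ffun 'I_n -> bool} -> bool.

Definition upd n (a : {ffun 'I_n -> bool}) (i : 'I_n) (x : bool) :
    {ffun 'I_n -> bool} :=
  [ffun k => if k == i then x else a k].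

Definition minor m n (g : boolfun m) (f : boolfun n) : bool :=
  [exists s : {ffun 'I_n -> 'I_m},
    [forall a : {ffun 'I_m -> bool}, g a == f [ffun i => a (s i)]]].

Definition minor_equiv m n (f : boolfun m) (g : boolfun n) : bool :=
  minor f g && minor g f.

Definition strict_minor m n (g : boolfun m) (f : boolfun n) : bool :=
  minor g f && ~~ minor f g.

Definition join_irreducible n (f : boolfun n) : Prop :=
  exists (m : nat) (f' : boolfun m),
    [/\ 0 < m, strict_minor f' f &
        forall (k : nat) (g : boolfun k),
          0 < k -> strict_minor g f -> minor g f'].

Definition essential n (f : boolfun n) (i : 'I_n) : bool :=
  [exists a : {ffun 'I_n -> bool}, [exists x : bool, [exists y : bool,
    f (upd a i x) != f (upd a i y)]]].

Definition Ess n (f : boolfun n) : {set 'I_n} := [set i | essential f i]%SET.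

Definition ess n (f : boolfun n) : nat := #|Ess f|.

(* A strict minor g of f has ess g < ess f, so the subtraction is exact. *)
Definition gap_values n (f : boolfun n) : set nat :=
  [set d | exists (m : nat) (g : boolfun m),
    [/\ 0 < m, strict_minor g f & d = ess f - ess g]]%classic.

(* The minimum of gap_values f. This set is empty iff ess f < 2, and then
   gap f takes the default value 0, which is never a genuine gap. *)
Definition gap n (f : boolfun n) : nat :=
  xget 0 [set d | gap_values f d /\
                  forall d', gap_values f d' -> d <= d']%classic.

Definition identify n (f : boolfun n) (i j : 'I_n) : boolfun n :=
  fun a => f (upd a i (a j)).

Definition Ess2 n (f : boolfun n) : {set {set 'I_n}} :=
  [set p : {set 'I_n} | (p \subset Ess f) && (#|p| == 2)]%SET.

(* Since identify f i j and identify f j i are equivalent, the relations below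
   do not depend on the order in which the elements of a pair are listed. *)
Definition approx n (f : boolfun n) : rel {set 'I_n} := fun p q =>
  [exists i, exists j, exists i', exists j',
    [&& p == [set i; j]%SET, q == [set i'; j']%SET &
        minor_equiv (identify f i j) (identify f i' j')]].

Definition Cset n (f : boolfun n) : {set {set 'I_n}} :=
  [set p in Ess2 f | [exists i, exists j,
    (p == [set i; j]%SET) && (ess (identify f i j) == ess f - gap f)]]%SET.

(* Main.v *)
(** Every strict minor of f lies below some f_{i=j} with i, j essential, so
    everything reduces to comparing these.  The key fact: if f_{i0=j0} is
    maximal among them and has at least two essential variables fewer than f,
    then all the f_{k=l} are equivalent.  Indeed, call {k,l} an edge when
    f_{k=l} is equivalent to f_{i0=j0}.  A variable m other than k that is lost
    in f_{k=l} may be merged with any u, so f_{k=l} <= f_{m=u}, and by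
    maximality m is adjacent to every u.  Let S be the nonempty set of such
    universal vertices and suppose that v is not in S.  For i in S, f_{i=v}
    loses some phi(i) in S, and phi has a cycle Z in S.  Following the cycle, f
    does not change on Z as long as some coordinate in Z equals x_v.
    Hence identifying i and phi(i) in Z can lose no variable but v, and
    as it loses one, v is in S, a contradiction. *)
Require Import Defs.
From mathcomp Require Import all_boot.
From mathcomp Require boolp classical_sets.

Set Implicit Arguments.
Unset Strict Implicit.
Unset Printing Implicit Defensive.

(** * Coordinate updates and the minor quasi-order *)

Lemma updE n (a : {ffun 'I_n -> bool}) i x k :
  upd a i x k = if k == i then x else a k.
Proof. by rewrite ffunE. Qed.

Lemma upd_id n (a : {ffun 'I_n -> bool}) i x : a i = x -> upd a i x = a.
Proof. by move=> <-; apply/ffunP=> k; rewrite updE; case: eqP => // ->. Qed.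

Lemma minorP m n (g : boolfun m) (f : boolfun n) :
  reflect (exists s : 'I_n -> 'I_m, forall a, g a = f [ffun i => a (s i)])
          (minor g f).
Proof.
apply: (iffP existsP) => [[s /forallP gs]|[s gs]].
  by exists s => a; apply/eqP.
exists (finfun s); apply/forallP=> a; rewrite gs; apply/eqP; congr (f _).
by apply/ffunP=> i; rewrite !ffunE.
Qed.

Lemma minor_refl n (f : boolfun n) : minor f f.
Proof.
apply/minorP; exists id => a; congr (f _).
by apply/ffunP=> i; rewrite ffunE.
Qed.

Lemma minor_trans m n k (g : boolfun n) (f : boolfun m) (h : boolfun k) :
  minor f g -> minor g h -> minor f h.
Proof.
move=> /minorP[s fs] /minorP[t gt]; apply/minorP; exists (s \o t) => a.
by rewrite fs gt; congr (h _); apply/ffunP=> i; rewrite !ffunE.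
Qed.

(** * Essential variables and their images in minors *)

Lemma nonessentialE n (f : boolfun n) i a x :
  i \notin Ess f -> f (upd a i x) = f a.
Proof.
rewrite inE => /existsPn /(_ a) /existsPn /(_ x) /existsPn /(_ (a i)).
by rewrite negbK => /eqP ->; rewrite upd_id.
Qed.

Lemma essentialP n (f : boolfun n) i :
  reflect (exists a x, f (upd a i x) != f a) (i \in Ess f).
Proof.
apply: (iffP idP) => [|[a [x fx]]]; last first.
  by apply: contraNT fx => /nonessentialE ->.
rewrite inE => /existsP[a /existsP[x /existsP[y fxy]]].
exists (upd a i y), x; rewrite [upd _ i x](_ : _ = upd a i x) //.
by apply/ffunP=> k; rewrite !updE; case: eqP.
Qed.

(** The coordinates of [a] are replaced by those of [b] one at a time: an essential one already
    agrees, an inessential one does not affect [f]. *)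
Lemma eq_on_Ess n (f : boolfun n) (a b : {ffun 'I_n -> bool}) :
  {in Ess f, a =1 b} -> f a = f b.
Proof.
move=> ab; pose c (s : seq 'I_n) := [ffun k => if k \in s then b k else a k].
have fc s : f (c s) = f a.
  elim: s => [|i s IHs]; first by congr (f _); apply/ffunP=> k; rewrite ffunE.
  have -> : c (i :: s) = upd (c s) i (b i).
    by apply/ffunP=> k; rewrite updE !ffunE inE; case: eqP => [->|].
  case: (boolP (i \in Ess f)) => [fi|/nonessentialE ->] //.
  by rewrite upd_id // ffunE ab // if_same.
rewrite -(fc (enum 'I_n)); congr (f _).
by apply/ffunP=> k; rewrite ffunE mem_enum.
Qed.

Lemma Ess_minor m n (g : boolfun m) (f : boolfun n) (s : 'I_n -> 'I_m) :
  (forall a, g a = f [ffun i => a (s i)]) -> Ess g \subset s @: Ess f.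
Proof.
move=> gs; apply/subsetP=> j; apply: contraTT => js; apply/negP.
case/essentialP=> a [x /eqP[]]; rewrite !gs; apply: eq_on_Ess => i fi.
rewrite !ffunE; case: eqP => // si.
by case/imsetP: js; exists i.
Qed.

Lemma ess_minor m n (g : boolfun m) (f : boolfun n) :
  minor g f -> ess g <= ess f.
Proof.
case/minorP=> s /Ess_minor/subset_leq_card/leq_trans; apply.
exact: leq_imset_card.
Qed.

Lemma minor_of_inj m n (g : boolfun m) (f : boolfun n) (s : 'I_n -> 'I_m) :
  0 < n -> (forall a, g a = f [ffun i => a (s i)]) ->
  {in Ess f &, injective s} -> minor f g.
Proof.
move=> n_gt0 gs s_inj; apply/minorP.
(* [t] inverts [s] on [s @: Ess f]; elsewhere it takes the index 0, available because [0 < n]. *)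
pose t j := odflt (Ordinal n_gt0) [pick i in Ess f | s i == j].
exists t => a; rewrite gs; apply: eq_on_Ess => i fi; rewrite !ffunE /t.
case: pickP => [k /andP[fk /eqP ski]|/(_ i)] /=; last by rewrite fi eqxx.
by rewrite (s_inj k i).
Qed.

(** [Ess g] lies in the image of [Ess f], so the cardinalities leave no room for [s] to merge two
    essential indices. *)
Lemma minor_ess_eq m n (g : boolfun m) (f : boolfun n) :
  0 < n -> minor g f -> ess f <= ess g -> minor f g.
Proof.
move=> n_gt0 /minorP[s gs] le_fg; apply: (minor_of_inj n_gt0 gs).
apply/imset_injP; rewrite eqn_leq leq_imset_card.
exact: leq_trans le_fg (subset_leq_card (Ess_minor gs)).
Qed.

Lemma strict_minor_ess m n (g : boolfun m) (f : boolfun n) :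
  0 < n -> strict_minor g f -> ess g < ess f.
Proof.
move=> n_gt0 /andP[gf]; rewrite ltnNge; apply: contra.
exact: minor_ess_eq.
Qed.

(** * Identification of two variables *)

Lemma minor_to_identify m n (g : boolfun m) (f : boolfun n)
    (s : 'I_n -> 'I_m) i j :
  (forall a, g a = f [ffun k => a (s k)]) -> s i = s j ->
  minor g (identify f i j).
Proof.
move=> gs sij; apply/minorP; exists s => a; rewrite gs /identify upd_id //.
by rewrite !ffunE sij.
Qed.

Lemma identify_comp n (f : boolfun n) i j a :
  identify f i j a = f [ffun k => a (if k == i then j else k)].
Proof. by congr (f _); apply/ffunP=> k; rewrite !ffunE; case: eqP. Qed.

Lemma identify_minor n (f : boolfun n) i j : minor (identify f i j) f.
Proof. by apply/minorP; eexists; exact: identify_comp. Qed.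

Lemma identify_sym n (f : boolfun n) i j :
  minor (identify f i j) (identify f j i).
Proof.
apply: minor_to_identify (identify_comp f i j) _.
by rewrite eqxx; case: eqP.
Qed.

Lemma Ess_identify n (f : boolfun n) i j :
  i != j -> j \in Ess f -> Ess (identify f i j) \subset Ess f :\ i.
Proof.
move=> ij fj; apply: subset_trans (Ess_minor (identify_comp f i j)) _.
apply/subsetP=> _ /imsetP[k fk ->]; rewrite in_setD1.
by case: (eqVneq k i) => [_|-> //]; rewrite eq_sym ij.
Qed.

Lemma identify_strict n (f : boolfun n) i j :
  i != j -> i \in Ess f -> j \in Ess f -> strict_minor (identify f i j) f.
Proof.
move=> ij fi fj; rewrite /strict_minor identify_minor /=; apply/negP.
move/ess_minor; apply/negP; rewrite -ltnNge /ess.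
rewrite (cardsD1 i (Ess f)) fi ltnS.
exact: subset_leq_card (Ess_identify ij fj).
Qed.

(** A substitution injective on [Ess f] could be undone, so a strict minor must merge two essential
    indices. *)
Lemma strict_minor_identify m n (g : boolfun m) (f : boolfun n) :
  0 < n -> strict_minor g f ->
  exists i j, [/\ i \in Ess f, j \in Ess f, i != j & minor g (identify f i j)].
Proof.
move=> n_gt0 /andP[/minorP[s gs] fg].
have [/existsP[i /existsP[j /and4P[fi fj ij /eqP sij]]]|s_inj] :=
  boolP [exists i, exists j, [&& i \in Ess f, j \in Ess f, i != j & s i == s j]].
  by exists i, j; split=> //; apply: minor_to_identify gs sij.
case/negP: fg; apply: (minor_of_inj n_gt0 gs) => i j fi fj sij.
apply/eqP; move/existsPn: s_inj => /(_ i)/existsPn/(_ j).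
by rewrite fi fj sij eqxx andbT negbK.
Qed.

Lemma identify_lost n (f : boolfun n) i j :
  i \in Ess f -> (ess (identify f i j)).+1 < ess f ->
  exists m, [/\ m \in Ess f, m != i & m \notin Ess (identify f i j)].
Proof.
move=> fi; rewrite /ess (cardsD1 i (Ess f)) fi ltnS => lt_card.
have /subsetPn[m] : ~~ (Ess f :\ i \subset Ess (identify f i j)).
  by apply: contraL lt_card => /subset_leq_card; rewrite -leqNgt.
by rewrite in_setD1 => /andP[mi fm] ?; exists m.
Qed.

(* As [m] does not matter after identifying [i] and [j], it may be merged
   with [u] as well. *)
Lemma minor_identify_lost n (f : boolfun n) i j m u :
  m != i -> m != u -> m \notin Ess (identify f i j) ->
  minor (identify f i j) (identify f m u).
Proof.
move=> mi mu lost; pose r k := if k == i then j else k.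
apply: (@minor_to_identify _ _ _ _
  (fun k => if r k == m then r u else r k)) => [a|].
  rewrite -(nonessentialE a (a (r u)) lost) identify_comp; congr (f _).
  by apply/ffunP=> k; rewrite !ffunE -/(r k); case: eqP.
rewrite /r (negPf mi) eqxx.
by case: (eqVneq u i) => _; [case: eqP | rewrite eq_sym (negPf mu)].
Qed.

(** * Cycles of lost variables *)

(** Forward orbits of points of [S] are stable under [phi]. Either one is a proper subset of [S],
    and induction on cardinality applies, or all equal [S], which is then a cycle. *)
Lemma exists_cycle (T : finType) (phi : T -> T) (S : {set T}) :
  S != set0 -> {in S, forall i, phi i \in S} ->
  exists Z : {set T}, [/\ Z \subset S, Z != set0 &
    {in Z, forall i, Z =i fconnect phi i}].
Proof.
elim: {S}_.+1 {-2}S (ltnSn #|S|) => // N IHN S; rewrite ltnS => le_SN S0 phiS.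
have sub i : i \in S -> [set k | fconnect phi i k] \subset S.
  move=> iS; apply/subsetP=> k; rewrite inE => /iter_findex <-.
  by elim: (findex _ _ _) => //= l /phiS.
have [/exists_inP[i iS neqS]|] :=
  boolP [exists i in S, [set k | fconnect phi i k] != S].
  have [|||Z [ZS Z0 Zcyc]] := IHN [set k | fconnect phi i k].
  - by apply: leq_trans le_SN; apply: proper_card; rewrite properEneq neqS sub.
  - by apply/set0Pn; exists i; rewrite inE.
  - move=> k; rewrite !inE => ik; apply: connect_trans ik _.
    exact: fconnect1.
  by exists Z; split=> //; apply: subset_trans ZS (sub _ iS).
move=> /exists_inPn cycS; exists S; split=> // i iS k.
by have := cycS i iS; rewrite negbK => /eqP {1}<-; rewrite inE.
Qed.

Section Cycle.

Variables (n : nat) (f : boolfun n) (v : 'I_n) (phi : 'I_n -> 'I_n).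
Variable Z : {set 'I_n}.
Hypothesis vZ : v \notin Z.
Hypothesis Zcyc : {in Z, forall i, Z =i fconnect phi i}.
Hypothesis phi_neq : {in Z, forall i, phi i != i}.
Hypothesis phi_lost : {in Z, forall i, phi i \notin Ess (identify f i v)}.

Let phiZ i : i \in Z -> phi i \in Z.
Proof. by move=> iZ; rewrite (Zcyc iZ); apply: fconnect1. Qed.

Let vNZ i : i \in Z -> (v == i) = false.
Proof. by move=> iZ; apply: contraNF vZ => /eqP ->. Qed.

(** Where coordinates [i] and [v] agree, [f] coincides with [identify f i v], which ignores [phi i];
    the update at [phi i] touches neither [i] nor [v]. *)
Lemma cycle_step i (a : {ffun 'I_n -> bool}) x :
  i \in Z -> a i = a v -> f (upd a (phi i) x) = f a.
Proof.
move=> iZ aiv; have /(nonessentialE a x) := phi_lost iZ.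
rewrite /identify (upd_id aiv) !updE vNZ ?phiZ // upd_id // updE.
by rewrite eq_sym (negPf (phi_neq iZ)).
Qed.

Definition fillZ (a : {ffun 'I_n -> bool}) x : {ffun 'I_n -> bool} :=
  [ffun k => if k \in Z then x else a k].

(* Starting from [a i = a v], the cycle can be reset to [a v] one variable
   after the other along [phi]. *)
Lemma cycle_const i (a : {ffun 'I_n -> bool}) :
  i \in Z -> a i = a v -> f a = f (fillZ a (a v)).
Proof.
move=> iZ aiv.
have reset N : forall j (b : {ffun 'I_n -> bool}), j \in Z -> b j = b v ->
    f b = f [ffun k => if k \in traject phi j N.+1 then b v else b k].
  elim: N => [|N IHN] j b jZ bjv.
    congr (f _); apply/ffunP=> k; rewrite ffunE inE.
    by case: eqP => // ->.
  rewrite -(cycle_step (b v) jZ bjv) (IHN (phi j)) ?phiZ //; last first.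
    by rewrite !updE eqxx vNZ ?phiZ.
  congr (f _); apply/ffunP=> k.
  rewrite [LHS]ffunE [RHS]ffunE !trajectS !in_cons !updE vNZ ?phiZ //.
  case: (eqVneq k (phi j)) (eqVneq k j) => [_|_] [->|_] //=.
  by rewrite bjv if_same.
(* A trajectory of length [order phi i] covers the whole orbit, that is [Z]; the predecessor offsets
   [N.+1] in [reset]. *)
rewrite (reset (order phi i).-1 i) //; congr (f _); apply/ffunP=> k.
by rewrite !ffunE prednK ?order_gt0 // -/(orbit phi i) -fconnect_orbit (Zcyc iZ).
Qed.

(** On tuples constant on [Z] the identification of [i] with [phi i] is invisible, and by
    [cycle_const] such tuples already exhibit all values of [f]. *)
Lemma essential_cycle i u :
  i \in Z -> u \in Ess f -> u != i -> u != v ->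
  u \in Ess (identify f i (phi i)).
Proof.
move=> iZ /essentialP[a [x fx]] ui uv; have kZ := phiZ iZ.
have ident (b : {ffun 'I_n -> bool}) :
    b i = b (phi i) -> identify f i (phi i) b = f b.
  by move=> bik; rewrite /identify upd_id.
have fillE b x' j : j \in Z -> fillZ b x' j = x' by move=> jZ; rewrite ffunE jZ.
have [uZ|uNZ] := boolP (u \in Z); last first.
  (* For [u] outside [Z]: if some coordinate in [Z] equals [a v], both tuples can be made constant
     on [Z]; otherwise [a] is already constant there, with value [~~ a v]. *)
  have [/exists_inP[j jZ /eqP ajv]|/exists_inPn aNv] :=
      boolP [exists j in Z, a j == a v].
    apply/essentialP; exists (fillZ a (a v)), x.
    have upd_fill : upd (fillZ a (a v)) u x = fillZ (upd a u x) (upd a u x v).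
      apply/ffunP=> k; rewrite !ffunE [v == u]eq_sym (negPf uv).
      by case: (eqVneq k u) => // ->; rewrite (negPf uNZ).
    rewrite upd_fill !ident ?fillE // -(cycle_const jZ ajv).
    rewrite -(cycle_const jZ) //.
    rewrite !updE [v == u]eq_sym (negPf uv).
    by case: eqP => // ju; rewrite -ju jZ in uNZ.
  have aZ j : j \in Z -> a j = ~~ a v.
    by move/aNv; case: (a j) (a v) => [] [].
  have aik : a i = a (phi i) by rewrite (aZ i iZ) (aZ _ kZ).
  apply/essentialP; exists a, x; rewrite !ident // !updE aik.
  rewrite [i == u]eq_sym (negPf ui).
  by case: eqP => // ku; rewrite -ku kZ in uNZ.
(* Now [u] is in [Z]. Among the tuples agreeing with [a] off [Z], only [b] has no coordinate in [Z]
   equal to [a v]. *)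
pose b := fillZ a (~~ a v).
have reset (c : {ffun 'I_n -> bool}) j :
    (forall k, k \notin Z -> c k = a k) -> j \in Z -> c j = a v ->
    f c = f (fillZ a (a v)).
  move=> ca jZ cj; have cv : c v = a v by rewrite ca.
  rewrite (cycle_const jZ) ?cv //; congr (f _); apply/ffunP=> k.
  by rewrite !ffunE; case: ifPn => // /ca.
(* Otherwise [f] would be constant on those tuples, two of which are [a] and [upd a u x]. *)
have fb : f b != f (fillZ a (a v)).
  apply: contra fx => /eqP fb.
  suff const (c : {ffun 'I_n -> bool}) :
      (forall k, k \notin Z -> c k = a k) -> f c = f (fillZ a (a v)).
    rewrite (const a) // (const (upd a u x)) // => k kNZ; rewrite updE.
    by case: eqP => // ku; rewrite ku uZ in kNZ.
  move=> ca; have [/exists_inP[j jZ /eqP]|/exists_inPn cNv] :=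
    boolP [exists j in Z, c j == a v]; first exact: reset.
  rewrite -fb; congr (f _); apply/ffunP=> k; rewrite ffunE.
  by case: ifPn => [/cNv|/ca //]; case: (c k) (a v) => [] [].
(* Setting [u] to [a v] creates a coordinate of [Z] equal to [a v], which survives the
   identification since [u != i]. *)
apply/essentialP; exists b, (a v).
rewrite (ident b) ?fillE // /identify.
rewrite (reset (upd _ i _) u) 1?eq_sym // => [k kNZ|]; last first.
  by rewrite !updE (negPf ui) eqxx.
rewrite !updE !ffunE (negPf kNZ).
by do 2![case: eqP => [ku|_]; first by rewrite ku ?iZ ?uZ in kNZ].
Qed.

End Cycle.

(** * Maximal identifications and the dichotomy *)

Section MaximalIdentification.

Variables (n : nat) (f : boolfun n) (i0 j0 : 'I_n).
Hypotheses (fi0 : i0 \in Ess f) (fj0 : j0 \in Ess f) (ij0 : i0 != j0).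
Hypothesis maximal : forall k l, k \in Ess f -> l \in Ess f -> k != l ->
  minor (identify f i0 j0) (identify f k l) ->
  minor (identify f k l) (identify f i0 j0).
Hypothesis deficient : (ess (identify f i0 j0)).+1 < ess f.

(** [E] records one half of the edge equivalence; [maximal] supplies the other. *)
Let E k l := minor (identify f i0 j0) (identify f k l).
Let S := [set m in Ess f | [forall u in Ess f, (u != m) ==> E m u]].

Let lost_in_S k l : k \in Ess f -> l \in Ess f -> k != l -> E k l ->
  exists m, [/\ m \in S, m != k & m \notin Ess (identify f k l)].
Proof.
move=> fk fl kl Ekl.
have [|m [fm mk lost]] := @identify_lost _ f k l fk.
  apply: leq_ltn_trans deficient; rewrite ltnS.
  exact: ess_minor (maximal fk fl kl Ekl).
exists m; split=> //; rewrite inE fm; apply/forall_inP=> u fu.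
apply/implyP=> um; apply: minor_trans Ekl _.
by apply: minor_identify_lost lost; rewrite // eq_sym.
Qed.

Lemma maximal_deficient k l :
  k \in Ess f -> l \in Ess f -> k != l ->
  minor (identify f i0 j0) (identify f k l).
Proof.
move=> fk fl kl.
have S_E i u : i \in S -> u \in Ess f -> u != i -> E i u.
  by rewrite inE => /andP[_ /forall_inP iS] fu; apply/implyP/iS.
have S_Ess i : i \in S -> i \in Ess f by rewrite inE => /andP[].
have [kS|vS] := boolP (k \in S); first by apply: S_E; rewrite // eq_sym.
pose v := k; pose phi i :=
  odflt i [pick m in S | (m != i) && (m \notin Ess (identify f i v))].
have phiP i : i \in S ->
    [/\ phi i \in S, phi i != i & phi i \notin Ess (identify f i v)].
  move=> iS; rewrite /phi; case: pickP => [m /and3P[]//|none].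
  have vi : v != i by apply: contraNneq vS; rewrite -/v => ->.
  have [||||m [mS mi lost]] := @lost_in_S i v; rewrite // 1?eq_sym //.
  - exact: S_Ess.
  - exact: S_E.
  by have := none m; rewrite mS mi lost.
have [|i /phiP[]//|Z [ZS /set0Pn[i iZ] Zcyc]] := @exists_cycle _ phi S.
  have [|m [mS _ _]] := @lost_in_S i0 j0 fi0 fj0 ij0; first exact: minor_refl.
  by apply/set0Pn; exists m.
have sZ j : j \in Z -> j \in S by apply/subsetP.
have iS := sZ _ iZ; have [pS pi _] := phiP _ iS.
(* The edge between [i] and [phi i] loses some [m] in [S] other than [i]; as [v] is not in [S], [m]
   differs from [v], against [essential_cycle]. *)
have [||||m [mS mi lost]] := @lost_in_S i (phi i).
- exact: S_Ess.
- exact: S_Ess.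
- by rewrite eq_sym.
- by apply: S_E => //; apply: S_Ess.
have mv : m != v by apply: contraNneq vS; rewrite -/v => <-.
case/negP: lost; apply: (@essential_cycle _ f v phi Z) => //.
- by apply: contra vS => /sZ.
- by move=> j /sZ/phiP[].
- by move=> j /sZ/phiP[].
- exact: S_Ess.
Qed.

End MaximalIdentification.

(** An identification above [f_{i=j}] with most essential variables is maximal, since a minor with
    no fewer essential variables is equivalent. *)
Lemma exists_maximal_identify n (f : boolfun n) i j :
  0 < n -> i \in Ess f -> j \in Ess f -> i != j ->
  exists i' j', [/\ i' \in Ess f, j' \in Ess f, i' != j',
    minor (identify f i j) (identify f i' j') &
    forall k l, k \in Ess f -> l \in Ess f -> k != l ->
      minor (identify f i' j') (identify f k l) ->
      minor (identify f k l) (identify f i' j')].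
Proof.
move=> n_gt0 fi fj ij.
pose P (q : 'I_n * 'I_n) := [&& q.1 \in Ess f, q.2 \in Ess f, q.1 != q.2 &
  minor (identify f i j) (identify f q.1 q.2)].
have P0 : P (i, j) by rewrite /P fi fj ij minor_refl.
case: (@arg_maxnP _ (i, j) P (fun q => ess (identify f q.1 q.2)) P0).
case=> i' j' /and4P[/= fi' fj' ij' le_ij] max.
exists i', j'; split=> // k l fk fl kl le_kl.
apply: minor_ess_eq => //; apply: (max (k, l)).
by rewrite /P fk fl kl (minor_trans le_ij).
Qed.

(** If some [f_{i=j}] lies below no identification losing just one variable, a maximal one above it
    loses at least two, and [maximal_deficient] makes all equivalent. *)
Lemma identify_dichotomy n (f : boolfun n) : 0 < n ->
  (forall i j k l, i \in Ess f -> j \in Ess f -> i != j ->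
     k \in Ess f -> l \in Ess f -> k != l ->
     minor (identify f i j) (identify f k l)) \/
  (forall i j, i \in Ess f -> j \in Ess f -> i != j ->
     exists k l, [/\ k \in Ess f, l \in Ess f, k != l,
       minor (identify f i j) (identify f k l) &
       (ess (identify f k l)).+1 = ess f]).
Proof.
move=> n_gt0.
have [/existsP[i /existsP[j /and4P[fi fj ij /forallP bad]]]|good] := boolP
  [exists i, exists j, [&& i \in Ess f, j \in Ess f, i != j &
    [forall k, forall l, [&& k \in Ess f, l \in Ess f, k != l &
      minor (identify f i j) (identify f k l)] ==>
      ((ess (identify f k l)).+1 != ess f)]]]; [left|right]; last first.
  move=> i j fi fj ij; move/existsPn: good => /(_ i)/existsPn/(_ j).
  rewrite fi fj ij /= => /forallPn[k /forallPn[l]].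
  by rewrite negb_imply negbK => /andP[/and4P[fk fl kl le_ij] /eqP]; exists k, l.
have [i' [j' [fi' fj' ij' le_ij max]]] := exists_maximal_identify n_gt0 fi fj ij.
have def : (ess (identify f i' j')).+1 < ess f.
  rewrite ltn_neqAle strict_minor_ess ?identify_strict // andbT.
  by move/forallP: (bad i') => /(_ j')/implyP; apply; rewrite fi' fj' ij'.
have le_all := maximal_deficient fi' fj' ij' max def.
move=> a b k l fa fb ab fk fl kl.
by apply: minor_trans (le_all _ _ fk fl kl); apply: max => //; apply: le_all.
Qed.

(** * The arity gap *)

Section Gap.

Variables (n : nat) (f : boolfun n).
Hypothesis n_gt0 : 0 < n.

Lemma gapP d0 : gap_values f d0 ->
  gap_values f (gap f) /\ forall d, gap_values f d -> gap f <= d.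
Proof.
move=> d0P; rewrite /gap.
suff [d dP] : exists d, gap_values f d /\ forall d', gap_values f d' -> d <= d'.
  by case: classical_sets.xgetP => [e _ //|/(_ d)].
elim/ltn_ind: d0 d0P => d IHd dP.
have [[e [eP /IHd]]|noe] := boolp.pselect (exists e, gap_values f e /\ e < d).
  by apply.
exists d; split=> // e eP; rewrite leqNgt; apply/negP=> lt_ed.
by apply: noe; exists e.
Qed.

(** The default of [xget] is 0, so a positive gap is a genuine minimum. *)
Lemma gap_valuesP d0 : gap f = d0.+1 -> gap_values f (gap f).
Proof. by rewrite /gap; case: classical_sets.xgetP => // d -> []. Qed.

Lemma strict_minor_gap_values m (g : boolfun m) :
  0 < m -> strict_minor g f -> gap_values f (ess f - ess g).
Proof. by exists m, g. Qed.

Lemma strict_minor_le_gap m (g : boolfun m) :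
  0 < m -> strict_minor g f -> ess g <= ess f - gap f.
Proof.
move=> m_gt0 gf; have gv := strict_minor_gap_values m_gt0 gf.
have [_ /(_ _ gv) le_gap] := gapP gv.
by rewrite -(subKn (ltnW (strict_minor_ess n_gt0 gf))) leq_sub2l.
Qed.

(** A strict minor realizing the gap lies below some identification, which cannot have more
    essential variables by minimality of the gap. *)
Lemma gap_attained : gap_values f (gap f) ->
  exists i j, [/\ i \in Ess f, j \in Ess f, i != j &
    ess (identify f i j) = ess f - gap f].
Proof.
move=> [m [g [m_gt0 gltf gapE]]].
have [i [j [fi fj ij le_g]]] := strict_minor_identify n_gt0 gltf.
exists i, j; split=> //; apply/eqP.
rewrite eqn_leq strict_minor_le_gap ?identify_strict //= gapE.
by rewrite subKn ?(ltnW (strict_minor_ess _ gltf)) // ess_minor.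
Qed.

End Gap.

(** * Pairs of essential variables *)

Lemma set2_inj (T : finType) (i j k l : T) : i != j ->
  [set i; j] = [set k; l] -> (k = i /\ l = j) \/ (k = j /\ l = i).
Proof.
move=> ij eq_p.
have := set21 k l; rewrite -eq_p => /set2P kij.
have := set22 k l; rewrite -eq_p => /set2P lij.
have kl : k != l.
  have : #|[set i; j]| = #|[set k; l]| by rewrite eq_p.
  by rewrite !cards2 ij; case: (k != l).
case: kij lij kl => -> [] ->; rewrite ?eqxx //; tauto.
Qed.

Lemma minor_equiv_ess m k (g : boolfun m) (h : boolfun k) :
  minor_equiv g h -> ess g = ess h.
Proof. by case/andP=> gh hg; apply/eqP; rewrite eqn_leq !ess_minor. Qed.

Section Pairs.

Variables (n : nat) (f : boolfun n).

Lemma Ess2P p : reflect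
  (exists i j, [/\ p = [set i; j], i \in Ess f, j \in Ess f & i != j])
  (p \in Ess2 f).
Proof.
rewrite inE; apply: (iffP andP) => [[pf /cards2P[i [j [ij pE]]]]|].
  by exists i, j; split=> //; apply: (subsetP pf); rewrite pE !inE eqxx ?orbT.
move=> [i [j [-> fi fj ij]]]; rewrite cards2 ij subUset !sub1set.
by rewrite fi fj.
Qed.

Lemma ess_gt1 i j : i \in Ess f -> j \in Ess f -> i != j -> 1 < ess f.
Proof.
move=> fi fj ij; have <- : #|[set i; j]| = 2 by rewrite cards2 ij.
by apply: subset_leq_card; rewrite subUset !sub1set fi fj.
Qed.

(** The witnesses in [approx] may list a pair in either order; [identify_sym] absorbs this. *)
Lemma approx_pair i j k l : i != j -> k != l ->
  approx f [set i; j] [set k; l] =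
  minor_equiv (identify f i j) (identify f k l).
Proof.
move=> ij kl; apply/idP/idP; last first.
  move=> eqv; apply/existsP; exists i; apply/existsP; exists j.
  by apply/existsP; exists k; apply/existsP; exists l; rewrite !eqxx.
case/existsP=> i' /existsP[j' /existsP[k' /existsP[l']]].
case/and3P=> /eqP/(set2_inj ij) eq_ij /eqP/(set2_inj kl) eq_kl /andP[le ge].
have sym := identify_sym f.
have le_ij : minor (identify f i j) (identify f i' j').
  by case: eq_ij => [[-> ->]|[-> ->]] //; apply: minor_refl.
have ge_ij : minor (identify f i' j') (identify f i j).
  by case: eq_ij => [[-> ->]|[-> ->]] //; apply: minor_refl.
have le_kl : minor (identify f k l) (identify f k' l').
  by case: eq_kl => [[-> ->]|[-> ->]] //; apply: minor_refl.
have ge_kl : minor (identify f k' l') (identify f k l).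
  by case: eq_kl => [[-> ->]|[-> ->]] //; apply: minor_refl.
by rewrite /minor_equiv (minor_trans le_ij (minor_trans le ge_kl))
  (minor_trans le_kl (minor_trans ge ge_ij)).
Qed.

Lemma Cset_pair i j : i \in Ess f -> j \in Ess f -> i != j ->
  ([set i; j] \in Cset f) = (ess (identify f i j) == ess f - gap f).
Proof.
move=> fi fj ij; rewrite inE.
have -> /= : [set i; j] \in Ess2 f by apply/Ess2P; exists i, j.
apply/idP/idP; last first.
  move=> ess_ij; apply/existsP; exists i; apply/existsP; exists j.
  by rewrite eqxx.
case/existsP=> k /existsP[l /andP[/eqP/(set2_inj ij)[[-> ->]|[-> ->]]]] //.
move=> /eqP <-; apply/eqP/minor_equiv_ess.
by rewrite /minor_equiv !identify_sym.
Qed.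

Lemma Cset_sub p : p \in Cset f -> p \in Ess2 f.
Proof. by rewrite inE => /andP[]. Qed.

End Pairs.

(** * Characterization of join-irreducibility *)

Theorem theorem2p15 (n : nat) (f : boolfun n) (n_gt0 : 0 < n) :
  (join_irreducible f <->
     2 <= ess f /\ Cset f \in equivalence_partition (approx f) (Ess2 f)) /\
  (gap f = 2 -> join_irreducible f /\ Cset f = Ess2 f).
Proof.
have irreducible i j : i \in Ess f -> j \in Ess f -> i != j ->
    (forall k l, k \in Ess f -> l \in Ess f -> k != l ->
       minor (identify f k l) (identify f i j)) -> join_irreducible f.
  move=> fi fj ij le_ij; exists n, (identify f i j).
  split=> // [|m g _ gf]; first exact: identify_strict.
  have [k [l [fk fl kl le_g]]] := strict_minor_identify n_gt0 gf.
  exact: minor_trans le_g (le_ij _ _ fk fl kl).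
split; [split|].
- move=> [m [f' [m_gt0 f'f max]]].
  have [gv _] := gapP (strict_minor_gap_values m_gt0 f'f).
  have [i [j [fi fj ij f'_le]]] := strict_minor_identify n_gt0 f'f.
  have [k0 [l0 [fk0 fl0 kl0 ess0]]] := gap_attained n_gt0 gv.
  (* [f_{i=j}] is above [f'], hence above every strict minor; being largest, it realizes the gap. *)
  have le_max k l : k \in Ess f -> l \in Ess f -> k != l ->
      minor (identify f k l) (identify f i j).
    move=> fk fl kl; apply: minor_trans f'_le.
    by apply: max => //; apply: identify_strict.
  have ess_ij : ess (identify f i j) = ess f - gap f.
    apply/eqP; rewrite eqn_leq -{2}ess0 ess_minor ?le_max // andbT.
    by apply: strict_minor_le_gap; rewrite // identify_strict.
  split; first exact: ess_gt1 fi fj ij.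
  apply/imsetP; exists [set i; j]; first by apply/Ess2P; exists i, j.
  apply/setP=> p; rewrite [RHS]inE.
  have [/Ess2P[k [l [-> fk fl kl]]]|pN] := boolP (p \in Ess2 f); last first.
    by apply: contraNF pN => /Cset_sub.
  rewrite Cset_pair // approx_pair //= -ess_ij.
  apply/eqP/idP => [ess_kl|/minor_equiv_ess //].
  by rewrite /minor_equiv le_max // minor_ess_eq ?le_max ?ess_kl.
- move=> [_ /imsetP[_ /Ess2P[i [j [-> fi fj ij]]] CE]].
  have in_C k l : k \in Ess f -> l \in Ess f -> k != l ->
      (ess (identify f k l) == ess f - gap f) =
      minor_equiv (identify f i j) (identify f k l).
    move=> fk fl kl; rewrite -Cset_pair // CE inE approx_pair //.
    by rewrite (_ : _ \in Ess2 f) //; apply/Ess2P; exists k, l.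
  have /eqP ess_ij : ess (identify f i j) == ess f - gap f.
    by rewrite in_C // /minor_equiv minor_refl.
  apply: (irreducible i j) => // k l fk fl kl.
  (* If the identifications are not all equivalent, [f_{k=l}] lies below one losing a single
     variable. None can lose fewer, so that pair is in [Cset f], hence equivalent to [f_{i=j}]. *)
  have [|/(_ k l fk fl kl)] := identify_dichotomy f n_gt0; first exact.
  move=> [k' [l' [fk' fl' kl' le_kl ess_kl']]]; apply: minor_trans le_kl _.
  suff : minor_equiv (identify f i j) (identify f k' l') by case/andP.
  rewrite -in_C // eqn_leq strict_minor_le_gap ?identify_strict //= -ess_ij.
  by rewrite -ltnS ess_kl' strict_minor_ess // identify_strict.
move=> gap2.
have [i [j [fi fj ij ess_ij]]] := gap_attained n_gt0 (gap_valuesP gap2).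
have [equiv|/(_ i j fi fj ij)] := identify_dichotomy f n_gt0; last first.
  (* Losing a single variable contradicts gap 2; [1 < ess f] keeps the truncated subtraction from
     hiding this. *)
  move=> [k [l [fk fl kl _ ess_kl]]].
  have := strict_minor_le_gap n_gt0 n_gt0 (identify_strict kl fk fl).
  have := ess_gt1 fk fl kl; rewrite gap2 -ess_kl subSS ltnS => e_gt0.
  by rewrite leqNgt ltn_subrL e_gt0.
split; first by apply: (irreducible i j) => // k l *; apply: equiv.
apply/setP=> p; apply/idP/idP=> [/Cset_sub //|/Ess2P[k [l [-> fk fl kl]]]].
by rewrite Cset_pair // -ess_ij eqn_leq !ess_minor // equiv.
Qed.
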